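(* Let $\varphi:\mathbf{R}^2\to\mathbf{R}^2$ be a non-isometric linear operator with complex spectrum and with $\det\varphi=1$. Then each trajectory of a point under the action of $\varphi$ belongs to some ellipse; that is, for every point $M\in\mathbf{R}^2$ there exists an ellipse in $\mathbf{R}^2$ containing the whole trajectory $\{\varphi^n(M): n\geqslant 0\}$ of $M$ under $\varphi$.
   Context: $\mathbf{R}^2$ is the standard two-dimensional Euclidean space. A linear operator on $\mathbf{R}^2$ has complex spectrum if the two roots of its characteristic polynomial are non-real complex conjugate numbers. *)

(* Defs.v *)
From mathcomp Require Import all_boot all_order all_algebra.
From mathcomp Require Import complex.
From mathcomp Require Import all_classical all_reals.

Set Implicit Arguments.
Unset Strict Implicit.
Unset Printing Implicit Defensive.

Import Order.TTheory GRing.Theory Num.Theory.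
Local Open Scope classical_set_scope.
Local Open Scope ring_scope.

(* The plane is 'rV[R]_2.  The norm that MathComp-Analysis attaches to
   matrices is the sup norm, hence an explicit Euclidean distance. *)
Definition edist (R : realType) (x y : 'rV[R]_2) : R :=
  Num.sqrt (\sum_(i < 2) (x 0 i - y 0 i) ^+ 2).

Definition isometric (R : realType) (f : 'rV[R]_2 -> 'rV[R]_2) : Prop :=
  forall x y, edist (f x) (f y) = edist x y.

(* The matrix [lin1_mx f] acts on row vectors from the right; the transposition
   with respect to the column convention does not affect the determinant or the
   characteristic polynomial. *)
Definition op_det (R : realType) (f : {linear 'rV[R]_2 -> 'rV[R]_2}) : R :=
  \det (lin1_mx f).

Definition op_char_poly (R : realType) (f : {linear 'rV[R]_2 -> 'rV[R]_2}) :
    {poly R} :=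
  char_poly (lin1_mx f).

(* Over R[i] the characteristic polynomial, which is monic of degree 2, factors
   as (X - z)(X - conj z) for some non-real z. *)
Definition has_complex_spectrum (R : realType)
    (f : {linear 'rV[R]_2 -> 'rV[R]_2}) : Prop :=
  exists z : R[i], complex.Im z != 0 /\
    map_poly (real_complex R) (op_char_poly f) =
      ('X - z%:P) * ('X - (conjc z)%:P).

(* Bifocal definition.  The strict inequality excludes segments, points and the
   empty set; F1 = F2 is allowed, so a circle of positive radius counts as an
   ellipse. *)
Definition is_ellipse (R : realType) (E : set 'rV[R]_2) : Prop :=
  exists (F1 F2 : 'rV[R]_2) (a : R),
    edist F1 F2 < 2 * a /\ E = [set x | edist x F1 + edist x F2 = 2 * a].

Definition trajectory (R : realType) (f : 'rV[R]_2 -> 'rV[R]_2)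
    (M : 'rV[R]_2) : set 'rV[R]_2 :=
  [set iter n f M | n in [set: nat]].

(* Main.v *)
Require Import Defs.
From mathcomp Require Import all_boot all_order all_algebra.
From mathcomp Require Import all_classical all_reals.
From mathcomp Require Import complex ring lra.

(** The area form gives a quadratic form attached to phi, namely
    Q(x) = det (x, phi x).  Since det phi = 1, Q (phi x) = det phi * Q(x) = Q(x),
    so each trajectory stays on one level set of Q ([invariant_qform]).  The
    discriminant of Q equals (tr phi)^2 - 4 det phi, that is, the discriminant of
    the characteristic polynomial; it is negative because the spectrum is not
    real ([trace_sqr_lt4]), so Q or - Q is positive definite.  A level set of a
    positive definite form at a positive value is an ellipse
    ([is_ellipse_qform]), which settles every M != 0.  The origin is fixed, and
    any circle through it will do.

    The bifocal description of the level set rests on one computation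
    ([bifocal_equation]): for foci F, - F and major semi-axis a, the locus
    |x - F| + |x + F| = 2 a has the equation
    a^2 |x|^2 - (x . F)^2 = a^2 (a^2 - |F|^2).  It remains to choose F and a so
    that the matrix a^2 I - F F^T is a multiple of the matrix of Q. *)

Set Implicit Arguments.
Unset Strict Implicit.
Unset Printing Implicit Defensive.

Import Order.TTheory GRing.Theory Num.Theory.
Local Open Scope classical_set_scope.
Local Open Scope ring_scope.

(** * Level sets of positive definite quadratic forms *)

Definition qform (R : realType) (p q r : R) (x : 'rV[R]_2) : R :=
  p * x 0 0 ^+ 2 + 2 * q * (x 0 0 * x 0 1) + r * x 0 1 ^+ 2.

(** Completing the square: p Q(x) = (p x0 + q x1)^2 + (p r - q^2) x1^2. *)
Lemma qform_gt0 (R : realType) (p q r : R) (x : 'rV[R]_2) :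
  0 < p -> q ^+ 2 < p * r -> x != 0 -> 0 < qform p q r x.
Proof.
move=> p0 pos x0; rewrite -(pmulr_rgt0 _ p0).
have -> : p * qform p q r x =
    (p * x 0 0 + q * x 0 1) ^+ 2 + (p * r - q ^+ 2) * x 0 1 ^+ 2.
  by rewrite /qform; ring.
have D0 : 0 < p * r - q ^+ 2 by rewrite subr_gt0.
have [x1|x1] := eqVneq (x 0 1) 0; last first.
  by rewrite ltr_wpDl ?sqr_ge0 // mulr_gt0 // exprn_even_gt0.
rewrite x1 expr0n !mulr0 !addr0 exprn_even_gt0 //=.
rewrite mulf_eq0 gt_eqF //=.
apply: contraNneq x0 => x00; apply/eqP/rowP=> i; rewrite mxE.
by case: (unliftP ord0 i) => [j|] -> //; rewrite ord1 -x1; congr (x 0 _); exact: val_inj.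
Qed.

Lemma edistE (R : realType) (x y : 'rV[R]_2) :
  edist x y = Num.sqrt ((x 0 0 - y 0 0) ^+ 2 + (x 0 1 - y 0 1) ^+ 2).
Proof.
rewrite /edist big_ord_recl big_ord1; congr (Num.sqrt (_ + (x 0 _ - y 0 _) ^+ 2));
  exact: val_inj.
Qed.

Lemma edist_ge0 (R : realType) (x y : 'rV[R]_2) : 0 <= edist x y.
Proof. exact: sqrtr_ge0. Qed.

Lemma sqr_edist (R : realType) (x y : 'rV[R]_2) :
  edist x y ^+ 2 = (x 0 0 - y 0 0) ^+ 2 + (x 0 1 - y 0 1) ^+ 2.
Proof. by rewrite edistE sqr_sqrtr // addr_ge0 ?sqr_ge0. Qed.

Lemma edist_eq (R : realType) (x y : 'rV[R]_2) (s : R) :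
  0 <= s -> (x 0 0 - y 0 0) ^+ 2 + (x 0 1 - y 0 1) ^+ 2 = s ^+ 2 ->
  edist x y = s.
Proof. by move=> s0 e; rewrite edistE e sqrtr_sqr ger0_norm. Qed.

(** On the locus the focal distances are affine in x:
    |x - F| = a - (x . F) / a and |x + F| = a + (x . F) / a.  The difference of
    their squares, 4 x . F, gives this from the sum 2 a; conversely the quadratic
    equation says that the squares of both sides agree, and the right-hand sides
    are nonnegative because |x . F| <= a^2 by Cauchy-Schwarz. *)
Lemma bifocal_equation (R : realType) (F x : 'rV[R]_2) (a : R) : 0 < a ->
  F 0 0 ^+ 2 + F 0 1 ^+ 2 < a ^+ 2 ->
  (edist x F + edist x (- F) = 2 * a) <->
  (a ^+ 2 * (x 0 0 ^+ 2 + x 0 1 ^+ 2) - (x 0 0 * F 0 0 + x 0 1 * F 0 1) ^+ 2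
     = a ^+ 2 * (a ^+ 2 - (F 0 0 ^+ 2 + F 0 1 ^+ 2))).
Proof.
move=> a0 Fa.
have := sqr_edist x F; have := sqr_edist x (- F).
have := @edist_eq R x F; have := @edist_eq R x (- F).
rewrite !mxE.
set u := x 0 0; set v := x 0 1; set f := F 0 0; set g := F 0 1.
move: Fa; rewrite -/f -/g; set d1 := edist x F; set d2 := edist x (- F).
move=> Fa eq2 eq1 sq2 sq1; set t := u * f + v * g.
have an0 : a != 0 by rewrite gt_eqF.
split=> [sum2a|conic].
  have prod2a : (d2 - d1) * (2 * a) = 4 * t.
    by rewrite -sum2a; transitivity (d2 ^+ 2 - d1 ^+ 2); [ring | rewrite sq1 sq2 /t; ring].
  have d2E : a * d2 = a ^+ 2 + t by nra.
  have : (a * d2) ^+ 2 = (a ^+ 2 + t) ^+ 2 by rewrite d2E.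
  rewrite exprMn sq2 /t; nra.
have CS : t ^+ 2 <= (u ^+ 2 + v ^+ 2) * (f ^+ 2 + g ^+ 2).
  by have := sqr_ge0 (u * g - v * f); rewrite /t; lra.
(* With CS, the equation gives
   (a^2 - |F|^2) |x|^2 <= (a^2 - |F|^2) a^2, and the common factor is positive. *)
have xa : u ^+ 2 + v ^+ 2 <= a ^+ 2.
  rewrite -subr_ge0 -(pmulr_rge0 _ (_ : 0 < a ^+ 2 - (f ^+ 2 + g ^+ 2))) ?subr_gt0 //.
  by rewrite -/t in conic; lra.
have t2 : t ^+ 2 <= (a ^+ 2) ^+ 2.
  apply: (le_trans CS); rewrite expr2; apply: ler_pM => //;
    by [rewrite addr_ge0 ?sqr_ge0 | exact: ltW].
have : `|t| <= a ^+ 2.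
  by rewrite -(ler_pXn2r (_ : (0 < 2)%N)) ?nnegrE ?sqr_ge0 // real_normK ?num_real.
rewrite ler_norml => /andP[tlo thi].
have ca : u ^+ 2 + v ^+ 2 + (f ^+ 2 + g ^+ 2) = a ^+ 2 + (t / a) ^+ 2.
  apply: (mulfI (_ : a ^+ 2 != 0)); first by rewrite expf_neq0.
  have -> : a ^+ 2 * (a ^+ 2 + (t / a) ^+ 2) = a ^+ 2 * a ^+ 2 + t ^+ 2 by field.
  by rewrite -/t in conic; lra.
have ta : a * (t / a) = t by field.
have -> : d1 = a - t / a.
  apply: eq1; first by rewrite subr_ge0 ler_pdivrMr // -expr2.
  transitivity (u ^+ 2 + v ^+ 2 + (f ^+ 2 + g ^+ 2) - 2 * t); first by rewrite /t; ring.
  by rewrite ca -{2}ta; ring.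
have -> : d2 = a + t / a.
  apply: eq2.
    by rewrite -(pmulr_rge0 _ a0) mulrDr ta -expr2; lra.
  transitivity (u ^+ 2 + v ^+ 2 + (f ^+ 2 + g ^+ 2) + 2 * t); first by rewrite /t; ring.
  by rewrite ca -{2}ta; ring.
by ring.
Qed.

(** Solves F F^T = (P, m; m, S) for a positive semidefinite matrix of rank at
    most one; the sign of m is carried by the second coordinate. *)
Lemma sqrt_pair (R : realType) (P S m : R) : 0 <= P -> 0 <= S -> P * S = m ^+ 2 ->
  exists f g : R, [/\ f ^+ 2 = P, g ^+ 2 = S & f * g = m].
Proof.
move=> P0 S0 PS.
have sPS : Num.sqrt P * Num.sqrt S = `|m| by rewrite -sqrtrM // PS sqrtr_sqr.
have [m0|m0] := lerP 0 m.
  by exists (Num.sqrt P), (Num.sqrt S); rewrite !sqr_sqrtr // sPS ger0_norm.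
exists (Num.sqrt P), (- Num.sqrt S).
by rewrite sqrrN !sqr_sqrtr // mulrN sPS ltr0_norm // opprK.
Qed.

(** Let mu be the larger eigenvalue of the matrix (p, q; q, r).  The matrix
    a^2 I - F F^T has larger eigenvalue a^2 and determinant a^2 (a^2 - |F|^2).
    If it is to be lam times the matrix of the form, and the right-hand side of
    the bifocal equation is to be lam * k, then a^2 = lam * mu and comparing
    determinants forces lam = k / (p r - q^2).  The remaining condition
    F F^T = lam (mu I - (p, q; q, r)) is solvable since the right-hand side is
    positive semidefinite and singular. *)
Lemma is_ellipse_qform (R : realType) (p q r k : R) :
  0 < p -> q ^+ 2 < p * r -> 0 < k -> is_ellipse [set x | qform p q r x = k].
Proof.
move=> p0 pos k0.
have r0 : 0 < r by rewrite -(pmulr_rgt0 _ p0); apply: le_lt_trans pos; exact: sqr_ge0.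
have D0 : 0 < p * r - q ^+ 2 by rewrite subr_gt0.
pose s := Num.sqrt ((p - r) ^+ 2 + 4 * q ^+ 2).
have s0 : 0 <= s by exact: sqrtr_ge0.
have s2 : s ^+ 2 = (p - r) ^+ 2 + 4 * q ^+ 2.
  by rewrite sqr_sqrtr //; have := sqr_ge0 (p - r); have := sqr_ge0 q; lra.
have : `|p - r| <= s.
  rewrite -(ler_pXn2r (_ : (0 < 2)%N)) ?nnegrE // real_normK ?num_real // s2.
  by have := sqr_ge0 q; lra.
rewrite ler_norml => /andP[slo shi].
pose mu := (p + r + s) / 2; pose lam := k / (p * r - q ^+ 2).
have lam0 : 0 < lam by exact: divr_gt0.
have kE : k = lam * (p * r - q ^+ 2) by rewrite /lam divfK // gt_eqF.
have mu0 : 0 < mu by rewrite /mu; lra.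
(* The characteristic equation of (p, q; q, r) at mu. *)
have muE : (mu - p) * (mu - r) = q ^+ 2 by rewrite /mu; nra.
have [f [g [f2 g2 fg]]] : exists f g : R,
    [/\ f ^+ 2 = lam * (mu - p), g ^+ 2 = lam * (mu - r) & f * g = - (lam * q)].
  apply: sqrt_pair; rewrite ?pmulr_rge0 // ?subr_ge0 /mu; try lra.
  by rewrite -/mu sqrrN exprMn -muE; ring.
pose a := Num.sqrt (lam * mu).
have lm0 : 0 < lam * mu by exact: mulr_gt0.
have a2 : a ^+ 2 = lam * mu by rewrite sqr_sqrtr // ltW.
have a0 : 0 < a by rewrite sqrtr_gt0.
pose F : 'rV[R]_2 := \row_i (if i == 0 then f else g).
have F0 : F 0 0 = f by rewrite mxE.
have F1 : F 0 1 = g by rewrite mxE.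
have bE : mu * (a ^+ 2 - (f ^+ 2 + g ^+ 2)) = k by rewrite a2 f2 g2 kE -muE; ring.
have Fa : f ^+ 2 + g ^+ 2 < a ^+ 2 by rewrite -subr_gt0 -(pmulr_rgt0 _ mu0) bE.
exists F, (- F), a; split.
  rewrite -(ltr_pXn2r (_ : (0 < 2)%N)) ?nnegrE ?edist_ge0 //; last by lra.
  have FN i : (- F) 0 i = - F 0 i by rewrite mxE.
  by rewrite sqr_edist !FN F0 F1; lra.
have quadE (x : 'rV[R]_2) : a ^+ 2 * (x 0 0 ^+ 2 + x 0 1 ^+ 2) - (x 0 0 * f + x 0 1 * g) ^+ 2
    = lam * qform p q r x.
  transitivity ((a ^+ 2 - f ^+ 2) * x 0 0 ^+ 2 + (a ^+ 2 - g ^+ 2) * x 0 1 ^+ 2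
     - 2 * (f * g) * (x 0 0 * x 0 1)); first by ring.
  by rewrite a2 f2 g2 fg /qform; ring.
have levelE : a ^+ 2 * (a ^+ 2 - (f ^+ 2 + g ^+ 2)) = lam * k.
  by rewrite {1}a2 -mulrA bE.
apply/seteqP; split => x /= h.
  by apply/bifocal_equation; rewrite ?F0 ?F1 // quadE levelE h.
move/bifocal_equation: h; rewrite F0 F1 => /(_ a0 Fa).
by rewrite quadE levelE; apply: mulfI; rewrite gt_eqF.
Qed.

(** * The quadratic form invariant under phi *)

(** For the roots x + i y and x - i y the trace is 2 x and the determinant
    x^2 + y^2 = 1, so the square of the trace is 4 - 4 y^2 with y != 0. *)
Lemma trace_sqr_lt4 (R : realType) (phi : {linear 'rV[R]_2 -> 'rV[R]_2}) :
  has_complex_spectrum phi -> op_det phi = 1 -> (\tr (lin1_mx phi)) ^+ 2 < 4.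
Proof.
move=> [z [z0 charE]] det1.
have c0 := congr1 (fun P : {poly R[i]} => complex.Re P`_0) charE.
have c1 := congr1 (fun P : {poly R[i]} => complex.Re P`_1) charE.
move: c0 c1; rewrite /op_char_poly !coef_map /=.
rewrite char_poly_det char_poly_trace // -/(op_det phi) det1.
have -> : ('X - z%:P) * ('X - (conjc z)%:P) =
   'X ^+ 2 - (z + conjc z)%:P * 'X + (z * conjc z)%:P :> {poly R[i]}.
  by rewrite rmorphD rmorphM /=; ring.
rewrite !coefD !coefN !coefXn !coefCM !coefX !coefC /=.
case: z z0 {charE} => x y /= y0.
rewrite sqrrN expr1n mulr1 => c0 c1.
have y2 : 0 < y ^+ 2 by rewrite exprn_even_gt0.
have -> : \tr (lin1_mx phi) = 2 * x by lra.
nra.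
Qed.

Lemma det2E (R : comNzRingType) (A : 'M[R]_2) :
  \det A = A 0 0 * A 1 1 - A 0 1 * A 1 0.
Proof.
rewrite (expand_det_row _ 0) big_ord_recl big_ord1 /cofactor !det_mx11 !mxE /=.
rewrite expr0 mul1r expr1 mulN1r mulrN.
by congr (A 0 _ * A _ _ - A 0 _ * A _ _); exact: val_inj.
Qed.

(** The form is Q(x) = det (x, phi x), or its opposite when the coefficient of
    the first square is negative; that coefficient cannot vanish, because the
    form is definite. *)
Lemma invariant_qform (R : realType) (phi : {linear 'rV[R]_2 -> 'rV[R]_2}) :
  has_complex_spectrum phi -> op_det phi = 1 ->
  exists p q r : R, [/\ 0 < p, q ^+ 2 < p * r &
    forall x, qform p q r (phi x) = qform p q r x].
Proof.
move=> spec det1; have := trace_sqr_lt4 spec det1.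
have ord1E : lift ord0 ord0 = 1 :> 'I_2 by exact: val_inj.
have phiE (x : 'rV[R]_2) j :
    phi x 0 j = x 0 0 * lin1_mx phi 0 j + x 0 1 * lin1_mx phi 1 j.
  by rewrite -mul_rV_lin1 mxE big_ord_recl big_ord1 ord1E.
move: det1; rewrite /op_det det2E /mxtrace big_ord_recl big_ord1 ord1E.
move: phiE; set A := lin1_mx phi.
set a := A 0 0; set b := A 0 1; set c := A 1 0; set d := A 1 1.
move=> phiE det1 tr4.
(* With A = (a, b; c, d) acting on rows,
   Q(x) = b x0^2 + (d - a) x0 x1 - c x1^2. *)
have disc : ((d - a) / 2) ^+ 2 < b * (- c).
  have -> : ((d - a) / 2) ^+ 2 = (a + d) ^+ 2 / 4 - (a * d - b * c) - b * c by field.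
  by rewrite det1; lra.
have inv x : qform b ((d - a) / 2) (- c) (phi x) = qform b ((d - a) / 2) (- c) x.
  rewrite /qform !phiE -/a -/b -/c -/d.
  transitivity ((a * d - b * c) * qform b ((d - a) / 2) (- c) x).
    by rewrite /qform; field.
  by rewrite det1 mul1r.
have qformN x : qform (- b) (- ((d - a) / 2)) c x = - qform b ((d - a) / 2) (- c) x.
  by rewrite /qform; ring.
have [b0|b0|b0] := ltrgtP b 0.
- exists (- b), (- ((d - a) / 2)), c; split; first by rewrite oppr_gt0.
    by rewrite sqrrN mulNr -mulrN.
  by move=> x; rewrite !qformN inv.
- by exists b, ((d - a) / 2), (- c).
- by move: disc; rewrite b0 mul0r ltNge sqr_ge0.
Qed.

Theorem mainTheorem4 (R : realType) (phi : {linear 'rV[R]_2 -> 'rV[R]_2})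
    (phi_noniso : ~ isometric phi)
    (phi_spec : has_complex_spectrum phi)
    (phi_det : op_det phi = 1) :
  forall M : 'rV[R]_2,
    exists E : set 'rV[R]_2, is_ellipse E /\ trajectory phi M `<=` E.
Proof.
move=> M; have [-> |M0] := eqVneq M 0.
  (* The unit circle with both foci at e passes through the origin. *)
  pose e : 'rV[R]_2 := delta_mx 0 0.
  exists [set x | edist x e + edist x e = 2 * 1]; split.
    exists e, e, 1; split=> //.
    by rewrite (_ : edist e e = 0) ?mulr1 //; apply: edist_eq; rewrite // !subrr; ring.
  have orbit0 n : iter n phi 0 = 0 by elim: n => //= n ->; rewrite linear0.
  move=> _ [n _ <-] /=; rewrite orbit0.
  have -> : edist 0 e = 1 by apply: edist_eq; rewrite // !mxE /=; ring.
  by ring.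
have [p [q [r [p0 pos inv]]]] := invariant_qform phi_spec phi_det.
exists [set x | qform p q r x = qform p q r M]; split.
  by apply: is_ellipse_qform => //; exact: qform_gt0.
by move=> _ [n _ <-] /=; elim: n => //= n <-.
Qed.
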